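(* Let $n\ge 1$ and let $a_{0},a_{1},\dots,a_{n}\in\mathbb{Z}$ with $a_{0}a_{n}\neq 0$, and suppose that $$(a_{0}+a_{2}m+a_{4}m^{2}+a_{6}m^{3}+\dots)^2-m(a_{1}+a_{3}m+a_{5}m^{2}+a_{7}m^{3}+\dots)^2=p\cdot q,$$ where $p$ is a prime number, $q$ is a positive integer and $m$ is a non-square positive integer. If $|a_{0}|>\sum_{i=1}^{n}|a_{i}|\left(\sqrt{m+q}\right)^{i}$, or if $q<m$ and $|a_{n}|>\sum_{i=0}^{n-1}|a_{i}|\left(\sqrt{m-q}\right)^{i-n}$, then the polynomial $\sum_{i=0}^{n}a_{i}X^{i}$ is irreducible over $\mathbb{Q}$.
   Context: The sums are $\sum_{i\ge 0}a_{2i}m^i$ and $\sum_{i\ge0}a_{2i+1}m^i$, with $a_i=0$ for $i>n$. *)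

(* Defs.v *)
From mathcomp Require Export all_boot all_order all_algebra.

(* Main.v *)
Require Import Defs.
From mathcomp Require Import all_boot all_order all_algebra.
From mathcomp Require Import algC complex.

(** Write [f] for the polynomial and [N g] for the product
    [g(sqrt m) g(- sqrt m)]; splitting [g] into its even and odd parts shows
    that [N g] is an integer, [surd_norm m g], and that the hypothesis says
    [N f = p q].

    Suppose that [f] is reducible over the rationals.  By Gauss's lemma
    [f = g h] with [g] and [h] non-constant integer polynomials, and
    [N g * N h = p q] because [N] is multiplicative ([surd_normM]).  The prime
    [p] divides one of the two factors, so the other one divides [q] and is at
    most [q] in absolute value ([irreducible_of_surd_norm]).

    The inequality on the coefficients forbids this.  It makes one end
    coefficient dominate the others, which confines the complex roots of [f]
    to [|x| > sqrt (m + q)] ([lt_norm_root]) or to [|x| < sqrt (m - q)]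
    ([gt_norm_root]); in both cases [|x ^ 2 - m| > q] for every root.  A
    non-constant factor [g] inherits its roots from [f], and [N g] is, up to
    sign, the square of its leading coefficient times the product of the
    [x ^ 2 - m] over these roots.  All these factors exceed [q >= 1], hence
    [|N g| > q] ([surd_norm_gt]), and likewise for [h]. *)

Import Order.TTheory GRing.Theory Num.Theory.
Local Open Scope ring_scope.

(** * Root location from a dominant end coefficient *)

(** A root inside the closed disc of radius [t] would make the constant term
    cancel against terms that are too small to do so. *)
Lemma lt_norm_root (C : numDomainType) (n : nat) (c : nat -> C) (t x : C) :
  0 <= t -> \sum_(1 <= i < n.+1) `|c i| * t ^+ i < `|c 0%N| ->
  \sum_(0 <= i < n.+1) c i * x ^+ i = 0 -> t < `|x|.
Proof.
move=> t0 hlt; rewrite big_nat_recl // expr0 mulr1 => /eqP.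
rewrite addr_eq0 => /eqP hc0; rewrite real_ltNge ?ger0_real //.
apply/negP => hxt; move: hlt; rewrite hc0 normrN big_add1 /=.
apply/negP; rewrite -real_leNgt ?ger0_real ?normr_ge0 //; last first.
  by apply: sumr_ge0 => i _; rewrite mulr_ge0 ?exprn_ge0.
apply: le_trans (ler_norm_sum _ _ _) _; apply: ler_sum => i _.
by rewrite normrM normrX ler_wpM2l // lerXn2r // nnegrE.
Qed.

(** Outside the open disc of radius [t] the top term beats all the others:
    relative to [|x| ^ n], the term of degree [i] has size
    [|c i| |x| ^- (n - i) <= |c i| t ^- (n - i)]. *)
Lemma gt_norm_root (C : numFieldType) (n : nat) (c : nat -> C) (t x : C) :
  0 < t -> \sum_(0 <= i < n) `|c i| * t ^- (n - i) < `|c n| ->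
  \sum_(0 <= i < n.+1) c i * x ^+ i = 0 -> `|x| < t.
Proof.
move=> t0 hlt; rewrite big_nat_recr //= addrC => /eqP.
rewrite addr_eq0 => /eqP hcn; rewrite real_ltNge ?ger0_real ?(ltW t0) //.
apply/negP => htx; have x0 : 0 < `|x| := lt_le_trans t0 htx.
have xX k : 0 < `|x| ^+ k by rewrite exprn_gt0.
move: hlt; apply/negP; rewrite -real_leNgt ?ger0_real //; last first.
  by apply: sumr_ge0 => i _; rewrite mulr_ge0 ?invr_ge0 ?exprn_ge0 ?(ltW t0).
rewrite -(ler_pM2r (xX n)) -normrX -normrM hcn normrN mulr_suml.
apply: le_trans (ler_norm_sum _ _ _) _; rewrite !big_nat.
apply: ler_sum => i /andP[_ lt_in].
rewrite normrM normrX -mulrA ler_wpM2l // normrX.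
rewrite -{2}(subnK (ltnW lt_in)) exprD mulrA ler_peMl ?(ltW (xX i)) // mulrC.
by rewrite ler_pdivlMr ?exprn_gt0 // mul1r lerXn2r // nnegrE ltW.
Qed.

(** * The norm of a polynomial at a square root *)

(** The norm of [p(sqrt m)] down to the integers: [p(sqrt m)] is [e + o sqrt m],
    where [e] and [o] are the values at [m] of the even and odd parts. *)
Definition surd_norm (m : int) (p : {poly int}) : int :=
  (even_poly p).[m] ^+ 2 - m * (odd_poly p).[m] ^+ 2.

Lemma surd_normE (C : comNzRingType) (m : int) (s : C) (p : {poly int}) :
  s ^+ 2 = m%:~R ->
  (surd_norm m p)%:~R
    = (map_poly intr p).[s] * (map_poly intr p).[- s].
Proof.
move=> hs.
have horner_surd (x : C) : x ^+ 2 = m%:~R ->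
    (map_poly intr p).[x]
      = (even_poly p).[m]%:~R + (odd_poly p).[m]%:~R * x.
  move=> hx; rewrite -{1}(poly_even_odd p) rmorphD rmorphM /=.
  rewrite !map_comp_poly /= map_polyXn map_polyX !hornerE !horner_comp.
  by rewrite !hornerE hx !horner_map.
rewrite !horner_surd ?sqrrN // mulrN mulrC -subr_sqr exprMn hs.
by rewrite /surd_norm intrB [m * _]mulrC !expr2 !intrM.
Qed.

(** The even and odd parts of a product mix, but the conjugate values
    [p(sqrt m)] and [p(- sqrt m)] are each multiplicative; embedding the
    integers in a field with a square root of [m] is enough to conclude. *)
Lemma surd_normM (m : int) (p q : {poly int}) :
  surd_norm m (p * q) = surd_norm m p * surd_norm m q.
Proof.
apply: (@intr_inj algC); have hs : sqrtC (m%:~R : algC) ^+ 2 = m%:~R.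
  by rewrite sqrtCK.
by rewrite rmorphM /= !(surd_normE _ _ _ _ hs) rmorphM /= !hornerM mulrACA.
Qed.

Lemma surd_norm_poly (n : nat) (a : nat -> int) (m : int) :
  (forall i : nat, (n < i)%N -> a i = 0) ->
  surd_norm m (\poly_(i < n.+1) a i)
    = (\sum_(0 <= i < n.+1) a (2 * i)%N * m ^+ i) ^+ 2
      - m * (\sum_(0 <= i < n.+1) a (2 * i + 1)%N * m ^+ i) ^+ 2.
Proof.
move=> ha; have coefF i : (\poly_(i < n.+1) a i)`_i = a i.
  by rewrite coef_poly ltnS; case: leqP => // /ha.
have leF : (size (\poly_(i < n.+1) a i)%R <= n.+1.*2)%N.
  by rewrite (leq_trans (size_poly _ _)) // -addnn leq_addr.
rewrite /surd_norm (even_polyE leF) (odd_polyE (leqW leF)).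
rewrite !horner_poly !big_mkord.
by congr (_ ^+ 2 - _ * _ ^+ 2); apply: eq_bigr => i _;
  rewrite coefF mul2n ?addn1.
Qed.

(** * Non-constant factors have large norm *)

Lemma lt_prod_seq (C : numDomainType) (T : eqType) (F : T -> C) (b : C)
    (r : seq T) :
  1 <= b -> r != [::] -> {in r, forall x, b < F x} ->
  b < \prod_(x <- r) F x.
Proof.
move=> b1; elim: r => // x r IHr _ hF; rewrite big_cons.
have hx : b < F x by rewrite hF ?mem_head.
have [->|r0] := eqVneq r [::]; first by rewrite big_nil mulr1.
have hr : b < \prod_(y <- r) F y.
  by apply: IHr => // y yr; rewrite hF // inE yr orbT.
apply: lt_le_trans hx _; rewrite ler_peMr //.
  by rewrite (le_trans ler01) // (le_trans b1) ?ltW ?hF ?mem_head.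
by rewrite (le_trans b1) ?ltW.
Qed.

(** With [r] the roots of [g] and [l] its leading coefficient,
    [|g(sqrt m) g(- sqrt m)| = l ^ 2 * \prod_(x <- r) |x ^ 2 - m|]; here
    [|l| >= 1] because [l] is a nonzero integer, and [r] is not empty because
    [g] is not constant. *)
Lemma surd_norm_gt (C : numClosedFieldType) (m : int) (q : nat)
    (g : {poly int}) :
  (0 < q)%N -> (1 < size g)%N ->
  (forall x : C, root (map_poly intr g) x -> q%:R < `|x ^+ 2 - m%:~R|) ->
  (q < `|surd_norm m g|)%N.
Proof.
move=> q0 gt1 hroot; pose gC : {poly C} := map_poly intr g.
have size_gC : size gC = size g.
  by rewrite size_map_inj_poly //; apply: intr_inj.
have [r Dg] := closed_field_poly_normal gC.
have g0 : g != 0 by rewrite -size_poly_gt0 ltnW.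
have lcE : lead_coef gC = (lead_coef g)%:~R.
  by rewrite lead_coef_map_inj //; apply: intr_inj.
have lc0 : lead_coef gC != 0 by rewrite lcE intr_eq0 lead_coef_eq0.
have rootE x : x \in r -> root gC x.
  by move=> xr; rewrite Dg rootZ ?root_prod_XsubC.
have r0 : r != [::].
  apply: contraTneq gt1 => r_nil; rewrite -size_gC Dg r_nil big_nil.
  by rewrite size_scale // size_poly1.
rewrite -(ltr_nat C) natr_absz intr_norm.
rewrite (@surd_normE _ _ (sqrtC m%:~R)) ?sqrtCK // -/gC Dg !hornerZ.
rewrite !horner_prod mulrACA -big_split /= normrM normr_prod.
have le1q : 1 <= q%:R :> C by rewrite ler1n.
apply: lt_le_trans (_ : \prod_(x <- r) `|x ^+ 2 - m%:~R| <= _).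
  by apply: lt_prod_seq => // x xr; apply: hroot; apply: rootE.
rewrite -[X in X <= _]mul1r.
have -> : \prod_(x <- r) `|x ^+ 2 - m%:~R|
   = \prod_(x <- r) `|('X - x%:P).[sqrtC m%:~R] * ('X - x%:P).[- sqrtC m%:~R]|.
  apply: eq_bigr => x _; rewrite !hornerE -[in LHS](sqrtCK m%:~R) subr_sqr.
  by rewrite -opprD mulrN normrN !normrM [X in X * _]distrC [_ + x]addrC.
rewrite ler_wpM2r ?prodr_ge0 // lcE -rmorphM /= -intr_norm ler1z.
by rewrite -gtz0_ge1 normr_gt0 mulf_neq0 ?lead_coef_eq0.
Qed.

(** * Irreducibility *)

(** In an integer factorization of [F] into non-constant [g] and [h], [p]
    divides one of the two norms, which leaves the other a divisor of [q],
    contrary to the lower bound on the norms of factors. *)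
Lemma irreducible_of_surd_norm (F : {poly int}) (m : int) (p q : nat) :
  prime p -> (0 < q)%N -> (1 < size F)%N ->
  surd_norm m F = p%:Z * q%:Z ->
  (forall g h : {poly int}, F = g * h -> (1 < size g)%N ->
     (q < `|surd_norm m g|)%N) ->
  irreducible_poly (map_poly intr F : {poly rat}).
Proof.
move=> p_pr q0 F_gt1 NF hfactor.
have F0 : F != 0 by rewrite -size_poly_gt0 ltnW.
have size_rat (P : {poly int}) : size (map_poly intr P : {poly rat}) = size P.
  by rewrite size_map_inj_poly //; apply: intr_inj.
split; first by rewrite size_rat.
move=> d d1 dF; rewrite -dvdp_size_eqp // size_rat.
(* Gauss's lemma: a rational divisor of F is, up to a scalar, an integer one. *)
have [g [c c0 Dd] [h DF]] := dvdpP_rat_int dF.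
have size_d : size d = size g by rewrite Dd size_scale ?size_rat.
move: F0; rewrite {1}DF mulf_eq0 negb_or => /andP[g0 h0].
apply: contraT; rewrite size_d {1}DF size_mul // => neq_size.
have g_gt1 : (1 < size g)%N.
  by rewrite ltn_neqAle eq_sym -size_d d1 size_d size_poly_gt0.
have h_gt1 : (1 < size h)%N.
  rewrite ltn_neqAle size_poly_gt0 h0 andbT.
  by apply: contraNneq neq_size => <-; rewrite addn1.
(* The bound applies to both factors, since either can play the role of g. *)
have lt_gq := hfactor g h DF g_gt1.
have lt_hq := hfactor h g (etrans DF (mulrC _ _)) h_gt1.
have Npq : (`|surd_norm m g| * `|surd_norm m h| = p * q)%N.
  by rewrite -abszM -surd_normM -DF NF.
have p_dvd (u v : nat) : (u * v = p * q)%N -> (p %| u)%N -> (v <= q)%N.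
  move=> uv /dvdnP[k Du]; apply: dvdn_leq => //.
  apply/dvdnP; exists k; apply/eqP.
  by rewrite -(eqn_pmul2l (prime_gt0 p_pr)) -uv Du mulnA [(p * k)%N]mulnC.
have : (p %| `|surd_norm m g| * `|surd_norm m h|)%N by rewrite Npq dvdn_mulr.
rewrite Euclid_dvdM // => /orP[/(p_dvd _ _ Npq)|].
  by rewrite leqNgt lt_hq.
by move/(p_dvd _ _ (etrans (mulnC _ _) Npq)); rewrite leqNgt lt_gq.
Qed.

Theorem theorem5p5 (R : rcfType) (n : nat) (a : nat -> int) (p q m : nat)
  (hn : (1 <= n)%N)
  (ha : forall i : nat, (n < i)%N -> a i = 0)
  (ha0n : a 0%N * a n != 0)
  (hp : prime p)
  (hq : (0 < q)%N)
  (hm : (0 < m)%N)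
  (hmsq : ~ exists k : nat, m = (k ^ 2)%N)
  (hpq : (\sum_(0 <= i < n.+1) a (2 * i)%N * m%:Z ^+ i) ^+ 2
         - m%:Z * (\sum_(0 <= i < n.+1) a (2 * i + 1)%N * m%:Z ^+ i) ^+ 2
         = p%:Z * q%:Z)
  (hbound :
    (`|a 0%N|%:~R : R) >
      \sum_(1 <= i < n.+1)
        `|a i|%:~R * Num.sqrt (m%:R + q%:R : R) ^+ i
    \/
    (q < m)%N /\
    (`|a n|%:~R : R) >
      \sum_(0 <= i < n)
        `|a i|%:~R * Num.sqrt (m%:R - q%:R : R) ^ (i%:Z - n%:Z)) :
  irreducible_poly (\sum_(0 <= i < n.+1) (a i)%:~R *: 'X^i : {poly rat}).
Proof.
pose F := \poly_(i < n.+1) a i.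
have -> : \sum_(0 <= i < n.+1) (a i)%:~R *: 'X^i
    = map_poly intr F :> {poly rat}.
  rewrite big_mkord /F poly_def rmorph_sum; apply: eq_bigr => i _.
  by rewrite /= map_polyZ map_polyXn.
have an0 : a n != 0 by move: ha0n; rewrite mulf_eq0 negb_or => /andP[].
have size_F : size F = n.+1 by rewrite size_poly_eq.
apply: (@irreducible_of_surd_norm _ m%:Z p q) => //; first by rewrite size_F.
  by rewrite surd_norm_poly.
move=> g h DF g_gt1; apply: (@surd_norm_gt R[i]) => // x gx0.
have Fx0 : \sum_(0 <= i < n.+1) (a i)%:~R * x ^+ i = 0.
  have /rootP : root (map_poly intr F) x by rewrite DF rmorphM rootM gx0.
  rewrite /F poly_def rmorph_sum /= horner_sum big_mkord => rootFx.
  rewrite -[RHS]rootFx.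
  by apply: eq_bigr => i _; rewrite map_polyZ map_polyXn /= !hornerE.
have normR (z : int) : `|z%:~R : R[i]| = (`|z|%:~R : R)%:C%C.
  by rewrite -intr_norm rmorph_int.
(* The bounds live in the real closed field R and the roots in R[i]; j carries
   the former over as a ring morphism. *)
pose j : {rmorphism R -> R[i]} := real_complex R.
have jE (y : R) : y%:C%C = j y by [].
case: hbound => [hlt | [lt_qm hlt]].
- pose t := Num.sqrt (m%:R + q%:R : R).
  have t0 : 0 <= (t%:C)%C by rewrite ler0c sqrtr_ge0.
  have hx : (t%:C)%C < `|x|.
    apply: lt_norm_root t0 _ Fx0; rewrite normR.
    move: hlt; rewrite -ltcR; congr (_ < _); rewrite jE rmorph_sum.
    by apply: eq_bigr => i _; rewrite normR /= rmorphM rmorphXn.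
  have t2 : (t%:C)%C ^+ 2 = m%:R + q%:R.
    by rewrite jE -rmorphXn sqr_sqrtr ?addr_ge0 // rmorphD !rmorph_nat.
  have : (t%:C)%C ^+ 2 < `|x| ^+ 2 by rewrite ltrXn2r.
  rewrite t2 -ltrBrDl => /lt_le_trans; apply.
  by rewrite -normrX -[X in _ - X <= _]normr_nat lerB_dist.
- pose t := Num.sqrt (m%:R - q%:R : R).
  have mq : 0 < m%:R - q%:R :> R by rewrite subr_gt0 ltr_nat.
  have t0 : 0 < (t%:C)%C by rewrite ltcR sqrtr_gt0.
  have hx : `|x| < (t%:C)%C.
    apply: (gt_norm_root _ _ _ _ _ t0 _ Fx0); rewrite normR.
    move: hlt; rewrite -ltcR; congr (_ < _); rewrite jE rmorph_sum !big_nat.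
    apply: eq_bigr => i /andP[_ lt_in]; rewrite normR /= rmorphM.
    by rewrite -(opprB n%:Z) subzn ?(ltnW lt_in) // -exprnN fmorphV rmorphXn.
  have t2 : (t%:C)%C ^+ 2 = m%:R - q%:R.
    by rewrite jE -rmorphXn sqr_sqrtr ?ltW // rmorphB !rmorph_nat.
  have : `|x| ^+ 2 < (t%:C)%C ^+ 2 by rewrite ltrXn2r // ltW.
  rewrite t2 ltrBrDr -ltrBrDl => /lt_le_trans; apply.
  by rewrite -normrX distrC -[X in X - _ <= _]normr_nat lerB_dist.
Qed.
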